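(* Let $(\mathfrak g,J,g)$ be a unimodular almost abelian pseudo-Kähler Lie algebra. Then $g$ is flat.
   Context: Lie algebras are real and finite-dimensional. A Lie algebra is almost abelian if it has a codimension-one abelian ideal; it is unimodular if $\mathrm{tr}(\mathrm{ad}(X))=0$ for all $X$. A pseudo-Kähler structure on $\mathfrak g$ is a pair $(J,g)$ with $J\in\mathrm{End}(\mathfrak g)$, $J^2=-\mathrm{Id}$, $[X,Y]+J[JX,Y]+J[X,JY]-[JX,JY]=0$; $g$ a nondegenerate symmetric bilinear form of arbitrary signature with $g(JX,JY)=g(X,Y)$; and $\omega=g(J\cdot,\cdot)$ satisfying $\omega([X,Y],Z)+\omega([Y,Z],X)+\omega([Z,X],Y)=0$. The Levi-Civita connection on $\mathfrak g$ is given by $2g(\nabla_XY,Z)=g([X,Y],Z)-g([Y,Z],X)+g([Z,X],Y)$; $g$ is flat if $R(X,Y)=[\nabla_X,\nabla_Y]-\nabla_{[X,Y]}$ vanishes for all $X,Y$. *)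

(* Defs.v *)
From HB Require Import structures.
From mathcomp Require Import all_boot all_order all_algebra sesquilinear.
From mathcomp Require Import reals.
From mathcomp Require Import ring.

Set Implicit Arguments.
Unset Strict Implicit.
Unset Printing Implicit Defensive.

Import GRing.Theory Num.Theory passmx.
Local Open Scope ring_scope.

HB.mixin Record Vector_isLie (R : fieldType) L of Vector R L := {
  lie : L -> L -> L;
  lie_bilinear : bilinear_for *:%R *:%R lie;
  liexx : forall x, lie x x = 0;
  lie_jacobi : forall x y z,
    lie x (lie y z) + lie y (lie z x) + lie z (lie x y) = 0
}.

#[short(type="lieAlgebraType")]
HB.structure Definition LieAlgebra (R : fieldType) :=
  { L of Vector R L & Vector_isLie R L }.

Notation "[ 'lie' x , y ]" := (lie x y)
  (at level 0, x, y at level 99, format "[ 'lie'  x ,  y ]") : ring_scope.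

HB.instance Definition _ (R : fieldType) (L : lieAlgebraType R) :=
  bilinear_isBilinear.Build R L L L *:%R *:%R (@lie R L) lie_bilinear.

Section LieAlgebraTheory.
Variables (R : fieldType) (L : lieAlgebraType R).
Implicit Types (x y z : L) (f : 'End(L)) (h : {vspace L}).

Definition ad x : 'End(L) := linfun (lie x).

(* The trace is read off the basis [vbasis fullv]; by [lfun_trE], any other
   basis gives the same value. *)
Definition lfun_tr f : R :=
  \tr (mxof (vbasis {:L}) (vbasis {:L}) f).

Lemma lfun_trE (e : (\dim {:L}).-tuple L) f :
  basis_of {:L} e -> \tr (mxof e e f) = lfun_tr f.
Proof.
move=> eb; pose b := vbasis {:L}; have bb : basis_of {:L} b := vbasisP _.
have -> : mxof e e f = mxof e b \1 *m (mxof b b f *m mxof b e \1).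
  by rewrite -!mxof_comp // comp_lfun1r comp_lfun1l.
rewrite mxtrace_mulC -mulmxA -mxof_comp // comp_lfun1l mxof1 ?mulmx1 //.
exact: basis_free bb.
Qed.

Definition unimodular : Prop := forall x, lfun_tr (ad x) = 0.

Definition lie_ideal h : Prop := forall x y, y \in h -> [lie x, y] \in h.

Definition lie_abelian h : Prop := {in h &, forall x y, [lie x, y] = 0}.

Definition almost_abelian : Prop :=
  exists h, [/\ lie_ideal h, lie_abelian h & (\dim h).+1 = \dim {:L}].

End LieAlgebraTheory.

Arguments unimodular {R} L.
Arguments almost_abelian {R} L.

Lemma linfunE (F : fieldType) (U V : vectType F) (f : U -> V) (u : U) :
  linear f -> linfun f u = f u.
Proof.
move=> f_lin; pose lin := GRing.isLinear.Build F U V *:%R f f_lin.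
by rewrite (lfunE (HB.pack_for {linear U -> V} f lin)).
Qed.

Section Metric.
Variables (R : fieldType) (L : lieAlgebraType R) (g : {symmetric L}).
Implicit Types (x y z : L).

Lemma metric_nondegenerateP :
  nondegenerate g <-> (forall x, (forall y, g x y = 0) -> x = 0).
Proof.
rewrite /nondegenerate; split=> [/eqP radg x gx0|gnd].
  apply/eqP; rewrite -memv0 -radg; apply/mem_orthovP => y _; exact: gx0.
apply/eqP/vspaceP => x; rewrite memv0; apply/idP/eqP => [|->]; last exact: mem0v.
by move=> /mem_orthovP x_rad; apply: gnd => y; apply: x_rad; rewrite memvf.
Qed.

Lemma metric_sym x y : g x y = g y x.
Proof. by rewrite hermC expr0 mul1r. Qed.

(* x |-> g(x, .), as a linear map from L to its dual *)
Definition lowering : 'Hom(L, 'Hom(L, R^o)) :=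
  linfun (fun x => linfun (g x : L -> R^o)).

(* Twice the Levi-Civita connection, read through the metric: the Koszul
   formula for left-invariant vector fields. *)
Definition koszul x y z : R^o :=
  g [lie x, y] z - g [lie y, z] x + g [lie z, x] y.

Definition levi_civita x y : L :=
  (lowering^-1)%VF (linfun (fun z => 2^-1 * koszul x y z)).

Definition curvature x y z : L :=
  levi_civita x (levi_civita y z) - levi_civita y (levi_civita x z)
    - levi_civita [lie x, y] z.

Definition is_flat : Prop := forall x y z, curvature x y z = 0.

Lemma loweringE x y : lowering x y = g x y.
Proof.
have lin1 u : linear (g u : L -> R^o) by move=> a v w; rewrite linearPr.
have lin2 : linear (fun u : L => linfun (g u : L -> R^o)).
  move=> a u v; apply/lfunP => w.
  by rewrite add_lfunE scale_lfunE !linfunE // linearPl.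
by rewrite /lowering !linfunE.
Qed.

Lemma koszul_linear x y : linear (koszul x y).
Proof.
have gPl b u v t : g (b *: u + v) t = b * g u t + g v t by exact: linearPl.
have gPr b u v t : g u (b *: v + t) = b * g u v + g u t by exact: linearPr.
move=> a v w; rewrite /koszul.
have -> : [lie y, a *: v + w] = a *: [lie y, v] + [lie y, w].
  exact: lie_bilinear.2.
have -> : [lie a *: v + w, x] = a *: [lie v, x] + [lie w, x].
  exact: lie_bilinear.1.
rewrite !gPl gPr /GRing.scale /=; ring.
Qed.

Hypothesis gnd : nondegenerate g.

Lemma lowering_surj (f : 'Hom(L, R^o)) : lowering ((lowering^-1)%VF f) = f.
Proof.
have ker0 : lker lowering = 0%VS.
  apply/eqP/lker0P => u v /lfunP uv; apply/eqP; rewrite -subr_eq0; apply/eqP.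
  apply: (metric_nondegenerateP.1 gnd) => y.
  have -> : g (u - v) y = g u y - g v y by exact: linearBl.
  by rewrite -!loweringE uv subrr.
apply: limg_lfunVK; suff -> : limg lowering = fullv by exact: memvf.
apply/eqP; rewrite eqEdim subvf /= limg_dim_eq ?ker0 ?capv0 //.
by rewrite !dimvf /= /dim /= muln1.
Qed.

Lemma levi_civitaP (two_neq0 : 2 != 0 :> R) x y z :
  2 * g (levi_civita x y) z = koszul x y z.
Proof.
have lin : linear (fun t => 2^-1 * koszul x y t).
  by move=> a u v; rewrite koszul_linear mulrDr /GRing.scale /= mulrCA.
by rewrite -loweringE lowering_surj linfunE // mulVKf.
Qed.

Lemma levi_civita_unique (nabla : L -> L -> L) :
    2 != 0 :> R ->
    (forall x y z, 2 * g (nabla x y) z = koszul x y z) ->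
  nabla =2 levi_civita.
Proof.
move=> two_neq0 nablaE x y; apply/eqP; rewrite -subr_eq0; apply/eqP.
apply: (metric_nondegenerateP.1 gnd) => z.
have -> : g (nabla x y - levi_civita x y) z =
  g (nabla x y) z - g (levi_civita x y) z by exact: linearBl.
apply: (mulfI two_neq0).
by rewrite mulr0 mulrBr nablaE levi_civitaP // subrr.
Qed.

End Metric.

(* The fundamental form is omega(x, y) = g(J x, y); [pk_closed] says that
   d omega = 0. *)
Record pseudo_kahler (R : fieldType) (L : lieAlgebraType R)
    (J : 'End(L)) (g : {symmetric L}) : Prop := PseudoKahler {
  pk_complex : forall x, J (J x) = - x;
  pk_integrable : forall x y,
    [lie x, y] + J [lie J x, y] + J [lie x, J y] - [lie J x, J y] = 0;
  pk_nondegenerate : nondegenerate g;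
  pk_hermitian : forall x y, g (J x) (J y) = g x y;
  pk_closed : forall x y z, let omega u v := g (J u) v in
    omega [lie x, y] z + omega [lie y, z] x + omega [lie z, x] y = 0
}.

(* Main.v *)
Require Import Defs.
From HB Require Import structures.
From mathcomp Require Import all_boot all_order all_algebra sesquilinear.
From mathcomp Require Import reals.
From mathcomp Require Import ring lra.

(** Write g(x, y) for the metric and omega(x, y) = g(J x, y).  The codimension
one abelian ideal is the kernel of a linear form; let n be the vector which
represents that form through g, and put k = - J n, so that n = J k.  All
brackets are orthogonal to n, and if g(n, x) = 1 the whole Lie bracket is
determined by the single operator ad x:
  [y, z] = g(n, y) [x, z] - g(n, z) [x, y]      ([lie_normal]).

The argument has three steps.

Unimodularity makes k central.  Closedness of omega says that the adjoint of
ad x for omega is - ad x plus two operators of rank one.  An operator and its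
adjoint have the same trace ([lfun_tr_adjoint]), so tr(ad x) = 0 says that
omega([x, k], x) = 0.  Since omega(k, .) = g(n, .) vanishes on the ideal,
closedness kills all other components of [x, k] ([central_of_trace]).

Centrality of k makes all brackets orthogonal to k as well as to n ([k_lie]).
By integrability ad n then commutes with J.  If g(n, n) <> 0, the vector n is
a multiple of a possible x and this is immediate; if g(n, n) = 0, it forces n
to be central and closedness of omega gives the claim.

Finally choose u in the ideal with g(k, u) = 1 and take x = J u.  Integrability
and closedness show that ad x is almost skew for g: on the ideal the form
g([x, y], z) + g(y, [x, z]) equals 2 s g(k, y) g(k, z), where s = g([x, u], u)
([ad_symmetric_partE]).  The Koszul formula then gives
  nabla_y = g(n, y) A + s g(k, y) C,
with A and C explicit ([levi_civita_frame]).  As brackets are orthogonal to n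
and k, nabla_[y, z] = 0, and flatness amounts to s (A C - C A) = 0.  Evaluating
this form on the central vector k gives s g(n, n) = 0: either s = 0,
or n is null, hence central, and then A C = C A = 0 ([flat_frame]). *)

Set Implicit Arguments.
Unset Strict Implicit.
Unset Printing Implicit Defensive.

Local Open Scope ring_scope.
Import Order.TTheory GRing.Theory Num.Theory passmx.

(** * Traces of endomorphisms *)

Section Trace.
Variables (F : fieldType) (L : lieAlgebraType F).
Implicit Types (f : 'End(L)) (a : 'Hom(L, F^o)) (w : L).

Lemma lfun_trD f1 f2 : lfun_tr (f1 + f2) = lfun_tr f1 + lfun_tr f2.
Proof. by rewrite /lfun_tr !linearD. Qed.

Lemma lfun_trN f : lfun_tr (- f) = - lfun_tr f.
Proof. by rewrite /lfun_tr !linearN. Qed.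

Definition rank_one a w : 'End(L) := linfun (fun y => (a y : F) *: w).

Lemma rank_oneE a w y : rank_one a w y = (a y : F) *: w.
Proof.
rewrite /rank_one linfunE // => c u v.
by rewrite linearP scalerDl scalerA.
Qed.

Lemma lfun_tr_rank_one a w : lfun_tr (rank_one a w) = a w.
Proof.
rewrite /lfun_tr /mxtrace [in RHS](coord_vbasis (memvf w)) linear_sum.
apply: eq_bigr => i _.
by rewrite !mxE /= vecof_delta rank_oneE !linearZ /= mulrC.
Qed.

(** With G the Gram matrix of b, adjointness reads M G = G M'^T, so that M and
M'^T are conjugate. *)
Lemma lfun_tr_adjoint (b : L -> L -> F) f f' :
    (forall x, linear (b x : L -> F^o)) ->
    (forall y, linear ((fun x => b x y) : L -> F^o)) ->
    (forall x, (forall y, b x y = 0) -> x = 0) ->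
    (forall x y, b (f x) y = b x (f' y)) ->
  lfun_tr f = lfun_tr f'.
Proof.
move=> blinr blinl bnd bff'; set e := vbasis {:L}.
have eb : basis_of {:L} e := vbasisP _.
pose G : 'M[F]_(\dim {:L}) := \matrix_(i, j) b e`_i e`_j.
have bE x y : b x y = (rVof e x *m G *m (rVof e y)^T) 0 0.
  pose bx z := linfun (b z : L -> F^o).
  pose by' z := linfun ((fun x => b x z) : L -> F^o).
  have bxE z t : b z t = bx z t by rewrite linfunE.
  have byE z t : b t z = by' z t by rewrite linfunE.
  rewrite {1}(coord_vbasis (memvf y)) bxE linear_sum mxE.
  apply: eq_bigr => j _; rewrite linearZ /= -bxE !mxE [RHS]mulrC; congr (_ * _).
  rewrite {1}(coord_vbasis (memvf x)) byE linear_sum.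
  by apply: eq_bigr => i _; rewrite linearZ /= -byE !mxE.
have Gu : G \in unitmx.
  rewrite -row_free_unit -kermx_eq0; apply/rowV0P => v /sub_kermxP vG.
  apply/eqP; rewrite -(vecof_eq0 eb); apply/eqP; apply: bnd => y.
  by rewrite bE (vecofK eb) vG mul0mx mxE.
have MG : mxof e e f *m G = G *m (mxof e e f')^T.
  apply/matrixP => i j.
  have := bff' e`_i e`_j; rewrite !bE !(rVof_app e eb) !(rVofE eb).
  by rewrite trmx_mul trmx_delta -!mulmxA -!rowE !mulmxA -!colE !mxE.
rewrite /lfun_tr -/e -[LHS]mxtrace_tr -[mxof e e f](mulmxK Gu) MG.
by rewrite mxtrace_tr mxtrace_mulC mulmxA mulVmx // mul1mx mxtrace_tr.
Qed.

End Trace.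

(** * Almost abelian Lie algebras with a metric *)

Section Normal.
Variables (F : fieldType) (L : lieAlgebraType F) (g : {symmetric L}).
Implicit Types (x y z : L) (a : F).

Lemma adE x z : ad x z = [lie x, z].
Proof. by rewrite linfunE // => ? ? ?; rewrite linearPr. Qed.

Lemma lieDl x y z : [lie x + y, z] = [lie x, z] + [lie y, z].
Proof. exact: linearDl. Qed.
Lemma lieDr x y z : [lie z, x + y] = [lie z, x] + [lie z, y].
Proof. exact: linearDr. Qed.
Lemma lieNl x z : [lie - x, z] = - [lie x, z].
Proof. exact: linearNl. Qed.
Lemma lieNr x z : [lie z, - x] = - [lie z, x].
Proof. exact: linearNr. Qed.
Lemma lieZl a x z : [lie a *: x, z] = a *: [lie x, z].
Proof. exact: linearZl_LR. Qed.
Lemma lieZr a x z : [lie z, a *: x] = a *: [lie z, x].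
Proof. exact: linearZr_LR. Qed.
Definition lie_expand := (lieDl, lieDr, lieNl, lieNr, lieZl, lieZr).

Lemma lieC x y : [lie x, y] = - [lie y, x].
Proof.
apply/eqP; rewrite -addr_eq0; apply/eqP.
by have := liexx (x + y); rewrite !lie_expand !liexx add0r addr0.
Qed.

Lemma metricDl x y z : g (x + y) z = g x z + g y z.
Proof. exact: linearDl. Qed.
Lemma metricDr x y z : g z (x + y) = g z x + g z y.
Proof. exact: linearDr. Qed.
Lemma metricNl x z : g (- x) z = - g x z.
Proof. exact: linearNl. Qed.
Lemma metricNr x z : g z (- x) = - g z x.
Proof. exact: linearNr. Qed.
Lemma metricZl a x z : g (a *: x) z = a * g x z.
Proof. exact: linearZl_LR. Qed.
Lemma metricZr a x z : g z (a *: x) = a * g z x.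
Proof. exact: linearZr_LR. Qed.
Lemma metric0l x : g 0 x = 0.
Proof. by rewrite -(scale0r (0 : L)) metricZl mul0r. Qed.
Lemma metric0r x : g x 0 = 0.
Proof. by rewrite metric_sym metric0l. Qed.
Definition metric_expand :=
  (metricDl, metricDr, metricNl, metricNr, metricZl, metricZr).

Hypothesis gnd : nondegenerate g.

Lemma metric_inj x y : (forall z, g x z = g y z) -> x = y.
Proof.
move=> xy; apply/eqP; rewrite -subr_eq0; apply/eqP.
apply: (metric_nondegenerateP g).1 => // z.
by rewrite !metric_expand xy subrr.
Qed.

Lemma riesz (a : 'Hom(L, F^o)) : exists v, forall x, g v x = a x.
Proof.
by exists ((lowering g)^-1%VF a) => x; rewrite -loweringE lowering_surj.
Qed.

(** The metric turns the linear form that cuts out the ideal into a vector n.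
All brackets lie in the ideal because the quotient by it is a line, hence
abelian. *)
Lemma almost_abelian_normal : almost_abelian L ->
  exists n, [/\ n != 0, forall x y, g n [lie x, y] = 0 &
    forall x y, g n x = 0 -> g n y = 0 -> [lie x, y] = 0].
Proof.
case=> h [hI hA hdim].
have [x0 x0h] : exists x0, x0 \notin h.
  have /subvPn[x _ xh] : ~~ (fullv <= h)%VS.
    by apply/negP => /dimvS; rewrite -hdim ltnn.
  by exists x.
have x0n0 : x0 != 0 by apply: contraNneq x0h => ->; exact: mem0v.
have cap0 : (<[x0]> :&: h)%VS = 0%VS.
  apply/eqP; rewrite -subv0; apply/subvP => y; rewrite memv_cap memv0.
  case/andP => /vlineP[c ->]; rewrite scaler_eq0.
  have [//|c0 /= ch] := eqVneq c 0; case/negP: x0h.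
  by rewrite -(@scalerK F L c c0 x0) memvZ.
have sumE : (<[x0]> + h)%VS = fullv.
  apply/eqP; rewrite eqEdim subvf -hdim dimv_disjoint_sum //.
  by rewrite dim_vline x0n0 add1n ltnS leqnn.
have decomp y : exists c, y - c *: x0 \in h.
  have : y \in (<[x0]> + h)%VS by rewrite sumE memvf.
  case/memv_addP => _ /vlineP[c ->] [v vh ->]; exists c.
  by rewrite addrC addKr.
pose a : 'Hom(L, F^o) :=
  (linfun (coord [tuple x0] ord0 : L -> F^o) \o daddv_pi <[x0]> h)%VF.
have aE y c : y - c *: x0 \in h -> a y = c.
  move=> yh; rewrite /a comp_lfunE.
  rewrite linfunE; last by move=> ? ? ?; rewrite linearP.
  have -> : y = c *: x0 + (y - c *: x0) by rewrite addrC subrK.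
  rewrite linearD /= daddv_pi_id ?memvZ ?memv_line //.
  have -> : daddv_pi <[x0]> h (y - c *: x0) = 0.
    apply: (addIr (y - c *: x0)); rewrite add0r.
    rewrite -[X in _ + X = _](@daddv_pi_id _ _ h <[x0]>%VS) 1?capvC //.
    by rewrite daddv_pi_add // sumE memvf.
  rewrite addr0 linearZ /=.
  have /= -> := @coord_free _ _ _ [tuple x0] ord0 ord0; last by rewrite seq1_free.
  by rewrite mulr1.
have ah y : (y \in h) = (a y == 0).
  have [c yc] := decomp y; rewrite (aE _ _ yc).
  apply/idP/eqP => [yh|c0]; last by rewrite c0 scale0r subr0 in yc.
  apply/eqP; apply: contraNT x0h => c0; rewrite -(@scalerK F L c c0 x0) memvZ //.
  by rewrite -[c *: x0](subKr y) memvB.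
have [n nE] := riesz a.
exists n; split=> [|x y|x y].
- apply: contraNneq x0h => n0; rewrite ah -nE n0.
  by rewrite metric0l.
- apply/eqP; rewrite nE -ah.
  have [[c xc] [d yd]] := (decomp x, decomp y).
  have -> : [lie x, y] = [lie x, y - d *: x0] - d *: [lie x0, x - c *: x0].
    rewrite !lie_expand liexx scaler0 oppr0 addr0 (lieC x0 x) scalerN opprK.
    by rewrite addrNK.
  by rewrite memvB ?memvZ ?hI.
- by rewrite !nE => /eqP + /eqP; rewrite -!ah; exact: hA.
Qed.

End Normal.

(** * A pseudo-Kahler structure and a normal vector *)

Section Flat.
Variables (F : realFieldType) (L : lieAlgebraType F) (J : 'End(L)).
Variables (g : {symmetric L}) (k : L).
Implicit Types (x y z : L).
Hypothesis pk : pseudo_kahler J g.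
Let n := J k.
Hypothesis n_neq0 : n != 0.
Hypothesis n_lie : forall x y, g n [lie x, y] = 0.
Hypothesis n_abelian :
  forall x y, g n x = 0 -> g n y = 0 -> [lie x, y] = 0.

Let gnd : nondegenerate g := pk_nondegenerate pk.
Let JK x : J (J x) = - x := pk_complex pk x.

Lemma JD x y : J (x + y) = J x + J y. Proof. exact: linearD. Qed.
Lemma JN x : J (- x) = - J x. Proof. exact: linearN. Qed.
Lemma JZ (a : F) x : J (a *: x) = a *: J x. Proof. exact: linearZ. Qed.
Definition J_expand := (JD, JN, JZ).

Lemma metric_J x y : g (J x) y = - g x (J y).
Proof. by rewrite -(pk_hermitian pk x) JK metricNr opprK. Qed.

Lemma metric_k x : g k x = g n (J x).
Proof. by rewrite /n (pk_hermitian pk). Qed.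

Lemma metric_nk : g n k = 0.
Proof. by have := metric_J k k; rewrite -/n [g k _]metric_sym; lra. Qed.

Lemma lie_normal x y z : g n x = 1 ->
  [lie y, z] = g n y *: [lie x, z] - g n z *: [lie x, y].
Proof.
move=> nx.
have y0 : g n (y - g n y *: x) = 0 by rewrite !metric_expand nx mulr1 subrr.
have z0 : g n (z - g n z *: x) = 0 by rewrite !metric_expand nx mulr1 subrr.
have := n_abelian y0 z0; rewrite !lie_expand liexx ?scaler0 ?oppr0 ?addr0.
rewrite (lieC y x) scalerN opprK => /eqP.
by rewrite subr_eq0 => /eqP <-; rewrite addrK.
Qed.

Lemma pk_closedE x y z :
  g (J [lie x, y]) z + g (J [lie y, z]) x + g (J [lie z, x]) y = 0.
Proof. exact: (pk_closed pk). Qed.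

Lemma J_inj x : J x = 0 -> x = 0.
Proof. by move=> Jx; rewrite -[x]opprK -(JK x) Jx linear0 oppr0. Qed.

(** The explicit omega-adjoint of ad x is - ad x plus two rank one operators
with equal traces, omega([x, k], x); so a vanishing trace of ad x makes this
number vanish.  Closedness on (x, k, z) then gives omega([x, k], z) = 0 for
every z. *)
Lemma central_of_trace x : g n x = 1 -> unimodular L -> [lie x, k] = 0.
Proof.
move=> nx uni.
pose a := (lowering g x \o (J \o ad x))%VF.
have aE z : a z = g (J [lie x, z]) x.
  by rewrite !comp_lfunE /= loweringE adE metric_sym.
have [w wE] := riesz gnd a.
(* J w represents y |-> omega([x, y], x) through omega. *)
pose E' := - ad x + rank_one a k + rank_one (lowering g n) (J w).
have E'E z : E' z = - [lie x, z] + a z *: k + g n z *: J w.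
  by rewrite !add_lfunE opp_lfunE !rank_oneE adE loweringE.
have adj y z : g (J (ad x y)) z = g (J y) (E' z).
  rewrite E'E adE !metric_expand.
  have -> : g (J y) k = - g n y by rewrite metric_J metric_sym.
  have -> : g (J y) (J w) = a y by rewrite (pk_hermitian pk) metric_sym wE.
  have := pk_closedE x y z; rewrite (lie_normal y z nx) (lieC z x).
  rewrite !J_expand !metric_expand -!aE.
  have -> : g (J y) [lie x, z] = - g (J [lie x, z]) y.
    by rewrite metric_J metric_sym.
  lra.
have trE : lfun_tr (ad x) = lfun_tr E'.
  apply: (lfun_tr_adjoint (b := fun y z => g (J y) z)) => //.
  - by move=> ? c u v; rewrite linearPr.
  - by move=> ? c u v; rewrite linearP linearPl.
  - move=> u u0; apply: J_inj; apply: (metric_inj gnd) => y.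
    by rewrite u0 metric0l.
move: trE; rewrite !lfun_trD !lfun_trN !lfun_tr_rank_one uni oppr0 add0r.
rewrite loweringE -metric_k metric_sym wE => ak.
have {}ak : g (J [lie x, k]) x = 0 by rewrite -aE; lra.
apply: J_inj; apply: (metric_inj gnd) => z.
rewrite metric0l.
have := pk_closedE x k z; rewrite (lie_normal k z nx) metric_nk.
rewrite (metric_J _ k) -/n [g _ n]metric_sym n_lie.
by rewrite !J_expand !metric_expand mul0r ak mulr0 !subr0 addr0 => ->.
Qed.

(** Over an ordered field the ideal is not J-stable: J would act on the
quotient line by a scalar of square -1.  The explicit witness divides by
1 + c^2, with c = g(n, J x). *)
Lemma normal_frame : exists u, g n u = 0 /\ g n (J u) = 1.
Proof.
have [x nx] : exists x, g n x = 1.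
  have [v nv] : exists v, g n v != 0.
    have /lfunPn[v] : lowering g n != 0; last by rewrite loweringE lfunE; exists v.
    apply: contraNneq n_neq0 => n0; apply/eqP; apply: (metric_inj gnd) => z.
    by rewrite -loweringE n0 lfunE metric0l.
  by exists ((g n v)^-1 *: v); rewrite metricZr mulVf.
set c := g n (J x); have c1 : 1 + c ^+ 2 != 0 by apply: lt0r_neq0; nra.
exists ((1 + c ^+ 2)^-1 *: (c *: x - J x)).
rewrite !J_expand JK !metric_expand nx -/c; split; first by ring.
by field.
Qed.

(** * Consequences of k being central *)

Section Central.
Hypothesis k_central : forall x, [lie x, k] = 0.

Lemma lie_nJ y : [lie n, J y] = J [lie n, y].
Proof.
have := pk_integrable pk k y.
rewrite !(lieC k) !k_central -/n oppr0 linear0 add0r addr0.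
by move/eqP; rewrite subr_eq0 => /eqP.
Qed.

Section Frame.
Variable u : L.
Hypothesis nu : g n u = 0.
Hypothesis nJu : g n (J u) = 1.

Lemma ku : g k u = 1. Proof. by rewrite metric_k. Qed.
Lemma kJu : g k (J u) = 0.
Proof. by rewrite metric_k JK metricNr nu oppr0. Qed.

(** If n lies in the ideal, [n, y] = - g(n, y) [J u, n]; comparing [n, J u]
with J [n, u] = 0 gives the claim. *)
Lemma lie_n_of_null : g n n = 0 -> [lie J u, n] = 0.
Proof.
move=> nn; have := lie_nJ u; rewrite !(lie_normal n _ nJu) nn nJu nu.
by rewrite !scale0r subrr linear0 scale1r sub0r => /eqP; rewrite oppr_eq0 => /eqP.
Qed.

(** When n is null it is central, and closedness applies to it as it stands.
Otherwise n is transverse to the ideal, so every bracket is a combination of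
brackets with n, and g(k, [n, w]) = g(n, [n, J w]). *)
Lemma k_lie y z : g k [lie y, z] = 0.
Proof.
have [nn|nn] := eqVneq (g n n) 0.
  have nc w : [lie w, n] = 0.
    by rewrite (lie_normal w n nJu) lie_n_of_null // nn scale0r scaler0 subr0.
  have := pk_closedE y z n; rewrite (lieC n) !nc oppr0 linear0 !metric0l !addr0.
  by rewrite /n (pk_hermitian pk) metric_sym.
have n1 : g n ((g n n)^-1 *: n) = 1 by rewrite metricZr mulVf.
have kn w : g k [lie n, w] = 0 by rewrite metric_k -lie_nJ n_lie.
by rewrite (lie_normal y z n1) !lie_expand !metric_expand !kn !mulr0 subrr.
Qed.

Lemma lie_frame_J z : g n z = 0 -> g k z = 0 ->
  [lie J u, J z] = J [lie J u, z].
Proof.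
move=> nz kz; have := pk_integrable pk (J u) z.
rewrite JK !lieNl (n_abelian nu nz) (@n_abelian u (J z)) ?nu -?metric_k //.
rewrite !oppr0 linear0 !addr0 => /(congr1 J); rewrite linear0 JD JK.
by move=> /eqP; rewrite subr_eq0 => /eqP.
Qed.

(** Twice the g-symmetric part of ad (J u). *)
Let q y z := g [lie J u, y] z + g y [lie J u, z].
(** The only coefficient of [q] on the ideal. *)
Let s := g [lie J u, u] u.

(** Since ad (J u) commutes with J on the J-stable part of the ideal, this is
closedness of omega evaluated on (J u, y, J z). *)
Lemma ad_symmetric_part_ideal y z :
  g n y = 0 -> g n z = 0 -> g k z = 0 -> q y z = 0.
Proof.
move=> ny nz kz; have := pk_closedE (J u) y (J z).
rewrite (pk_hermitian pk) (n_abelian ny) -?metric_k // linear0 metric0l.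
rewrite (lieC (J z)) lie_frame_J // JN JK opprK /q [g y _]metric_sym; lra.
Qed.

(** Decompose along J u, u and the orthogonal complement of n and k; the
components in that complement contribute only through their pairing with
J u. *)
Lemma ad_symmetric_partE y z : q y z = 2 * s * g k y * g k z
  + g n y * g (J u) [lie J u, z] + g n z * g (J u) [lie J u, y].
Proof.
have split w : exists v, [/\ g n v = 0, g k v = 0 &
    w = g n w *: J u + g k w *: u + v].
  exists (w - (g n w *: J u + g k w *: u)); split.
  - by rewrite !metric_expand nJu nu; ring.
  - by rewrite !metric_expand kJu ku; ring.
  - by rewrite addrC subrK.
have [[y' [ny ky yE]] [z' [nz kz zE]]] := (split y, split z).
have C := metric_sym g.
have yz : g y' [lie J u, z'] = - g [lie J u, y'] z'.
  by apply/eqP; rewrite -addr_eq0 addrC; apply/eqP/ad_symmetric_part_ideal.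
have uz : g u [lie J u, z'] = - g [lie J u, u] z'.
  by apply/eqP; rewrite -addr_eq0 addrC; apply/eqP/ad_symmetric_part_ideal.
have uy : g u [lie J u, y'] = - g y' [lie J u, u].
  rewrite (C y'); apply/eqP; rewrite -addr_eq0 addrC.
  exact/eqP/ad_symmetric_part_ideal.
rewrite /q /s.
move: (g n y) (g k y) (g n z) (g k z) yE zE => a b c d -> ->.
rewrite !lie_expand liexx !metric_expand !(metric0l, metric0r).
rewrite (C [lie J u, y'] (J u)) (C [lie J u, y'] u) (C [lie J u, u] (J u)).
rewrite (C u [lie J u, u]) yz uz uy; ring.
Qed.

(** The Koszul formula, with every g(v, [J u, w]) rewritten in terms of
g([J u, v], w) by [ad_symmetric_partE]. *)
Lemma levi_civita_frame (p : L) :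
    (forall w, g p w = g (J u) [lie J u, w]) ->
  forall y z, levi_civita g y z =
    g n y *: ([lie J u, z] - (s * g k z) *: k - g n z *: p)
    + (s * g k y) *: (g k z *: n - g n z *: k).
Proof.
move=> pE y z; have C := metric_sym g; symmetry.
have two0 : 2 != 0 :> F by rewrite pnatr_eq0.
move: y z.
apply: (@levi_civita_unique _ _ g gnd (fun y z =>
    g n y *: ([lie J u, z] - (s * g k z) *: k - g n z *: p)
    + (s * g k y) *: (g k z *: n - g n z *: k)) two0) => x y z.
rewrite /koszul (lie_normal x y nJu) (lie_normal y z nJu) (lie_normal z x nJu).
rewrite !metric_expand !pE.
have Q v w : g v [lie J u, w] = 2 * s * g k v * g k w
  + g n v * g (J u) [lie J u, w] + g n w * g (J u) [lie J u, v]
  - g [lie J u, v] w.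
  by rewrite -ad_symmetric_partE /q addrC addKr.
rewrite (C [lie J u, z] y) (C [lie J u, z] x) (C [lie J u, x] y) (Q y z) (Q x z).
rewrite (C [lie J u, y] x) (Q x y) (C y [lie J u, x]); ring.
Qed.

(** [q] vanishes at the central vector k, while g(k, k) = g(n, n). *)
Lemma s_norm_n : s * g n n = 0.
Proof.
have := ad_symmetric_partE k k; rewrite /q k_central metric0l metric0r metric_nk !mul0r.
rewrite !addr0 (metric_k k) -/n => /esym/eqP.
by rewrite -!mulrA !mulf_eq0 pnatr_eq0 /= orbb -mulf_eq0 => /eqP.
Qed.

(** With the notation A, C for the two operators in [levi_civita_frame]: if
s = 0, only A survives and it commutes with itself.  If n is null, then
[J u, n] = 0, so A kills n and k, which span the image of C, while the image
of A is orthogonal to n and k, so C kills it: A C = C A = 0. *)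
Lemma flat_frame : is_flat g.
Proof.
have [p pE0] := riesz gnd (lowering g (J u) \o ad (J u))%VF.
have pE w : g p w = g (J u) [lie J u, w].
  by rewrite pE0 comp_lfunE loweringE adE.
have nE := levi_civita_frame pE.
have kp : g k p = 0 by rewrite metric_sym pE k_central metric0r.
have nk := metric_nk; have kn : g k n = 0 by rewrite metric_sym.
have kk : g k k = g n n by rewrite /n (pk_hermitian pk).
have [s0|s0] := eqVneq s 0.
  move=> x y z; rewrite /curvature !nE !n_lie !k_lie s0.
  apply: (metric_inj gnd) => w; rewrite metric0l.
  rewrite !(lie_expand, metric_expand) !n_lie !k_lie ?nJu ?kJu ?k_central ?nk ?kp.
  by rewrite !metric0l; ring.
have nn : g n n = 0 by have /eqP := s_norm_n; rewrite mulf_eq0 (negbTE s0) => /eqP.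
have xn := lie_n_of_null nn.
have np : g n p = 0 by rewrite metric_sym pE xn metric0r.
move=> x y z; rewrite /curvature !nE !n_lie !k_lie.
apply: (metric_inj gnd) => w; rewrite metric0l.
rewrite !(lie_expand, metric_expand) !n_lie !k_lie kk nn nk kn np kp xn !k_central.
by rewrite !metric0l; ring.
Qed.

End Frame.
End Central.
End Flat.

Theorem corollary2p5 (R : realType) (L : lieAlgebraType R)
    (J : 'End(L)) (g : {symmetric L}) :
  almost_abelian L -> unimodular L -> pseudo_kahler J g -> is_flat g.
Proof.
move=> aa uni pk.
have [n []] := almost_abelian_normal (pk_nondegenerate pk) aa.
have -> : n = J (- J n) by rewrite JN (pk_complex pk) opprK.
move: (- J n) => k n_neq0 n_lie n_abelian.
have [u [nu nJu]] := normal_frame pk n_neq0.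
have xk := central_of_trace pk n_lie n_abelian nJu uni.
have k_central x : [lie x, k] = 0.
  rewrite (lie_normal n_abelian x k nJu) xk scaler0 sub0r.
  by rewrite (metric_nk k pk) scale0r oppr0.
exact: (flat_frame pk n_lie n_abelian k_central nu nJu).
Qed.
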